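(* Let $H\subset\mathrm{Bu}_3$ be a subgroup, and let $A$ be a $\Lambda$-module equipped with an epimorphism $\Lambda^2\twoheadrightarrow A$. Then: (1) $H\subset H(A(H))$, $\ A(H)=A(H(A(H)))$ (as quotients of $\Lambda^2$), and $H(A)=H(A(H(A)))$. (2) If $H(A)$ has finite index in $\mathrm{Bu}_3$, there is a finite quotient module $A'$ of $A$ (equipped with the composed epimorphism $\Lambda^2\twoheadrightarrow A\twoheadrightarrow A'$) such that $H(A)=H(A')$. (3) If $A$ is finite, there is a decomposition $A=\bigoplus A_{\mathfrak m}$ into local modules $A_{\mathfrak m}$ (with $A_{\mathfrak m}$ being $\mathfrak m$-local for maximal ideals $\mathfrak m\subset\Lambda$). (4) If $A=\bigoplus A_i$ for some $\Lambda$-modules $A_i$ (each equipped with the composed epimorphism $\Lambda^2\twoheadrightarrow A\twoheadrightarrow A_i$), then $H(A)=\bigcap H(A_i)$.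
   Context: $\Lambda:=\mathbb Z[t,t^{-1}]$. The Burau group $\mathrm{Bu}_3\subset GL(2,\Lambda)$ is the subgroup generated by $\mathbb X=\begin{pmatrix}0&-t\\ t&-t\end{pmatrix}$, $\mathbb Y=\begin{pmatrix}0&-t\\ -t^2&0\end{pmatrix}$ and the scalar matrix $t\cdot 1$; it acts on column vectors in $\Lambda^2$ by left multiplication. For a subgroup $H\subset\mathrm{Bu}_3$ put $V(H):=\langle (h-1)\cdot u\mid u\in\Lambda^2,\ h\in H\rangle\subset\Lambda^2$ (the $\Lambda$-submodule generated by these elements) and $A(H):=\Lambda^2/V(H)$, equipped with the quotient epimorphism $\Lambda^2\twoheadrightarrow A(H)$. For a $\Lambda$-module $A$ equipped with an epimorphism $\phi\colon\Lambda^2\twoheadrightarrow A$ put $H(A)=H(\phi):=\{h\in\mathrm{Bu}_3\mid (h-1)\cdot\Lambda^2\subset\operatorname{Ker}(\phi)\}$, a subgroup of $\mathrm{Bu}_3$. For a maximal ideal $\mathfrak m\subset\Lambda$, an $\mathfrak m$-local module is a non-trivial $\Lambda$-module annihilated by $\mathfrak m^n$ for sufficiently large $n$; a local module is one that is $\mathfrak m$-local for some $\mathfrak m$. *)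

(* Defs.v *)
From HB Require Import structures.
From mathcomp Require Import all_boot all_order all_algebra.
From mathcomp Require Import boolp classical_sets cardinality fsbigop.

Set Implicit Arguments.
Unset Strict Implicit.
Unset Printing Implicit Defensive.

Import GRing.Theory.
Local Open Scope ring_scope.
Local Open Scope classical_set_scope.
Local Open Scope quotient_scope.

(* The Laurent polynomial ring Z[t, t^-1], as the subring of the field of
   fractions Q(t) of Z[t] formed by the fractions p / t^n. *)

Local Notation "x %:F" := (tofrac x).

Definition laurent : {pred {fraction {poly int}}} :=
  fun x => `[< exists (p : {poly int}) (n : nat), x = p%:F / 'X%:F ^+ n >].

Lemma fracX_neq0 n : 'X%:F ^+ n != 0 :> {fraction {poly int}}.
Proof. by rewrite expf_neq0 // tofrac_eq0 polyX_eq0. Qed.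

Lemma tofrac_laurent (p : {poly int}) : p%:F \in laurent.
Proof. by apply/asboolP; exists p, 0; rewrite expr0 divr1. Qed.

Lemma laurent_subring_closed : subring_closed laurent.
Proof.
split=> [|x y|x y]; first by rewrite -tofrac1 tofrac_laurent.
- move=> /asboolP[p [m ->]] /asboolP[q [n ->]]; apply/asboolP.
  exists (p * 'X^n - q * 'X^m), (m + n)%N.
  rewrite tofracB !tofracM !tofracXn exprD -mulNr addf_div ?fracX_neq0 //.
  by rewrite mulNr.
- move=> /asboolP[p [m ->]] /asboolP[q [n ->]]; apply/asboolP.
  by exists (p * q), (m + n)%N; rewrite tofracM exprD mulf_div.
Qed.

Record Lambda :=
  MkLambda { Lambda_val : {fraction {poly int}}; _ : Lambda_val \in laurent }.

Notation "'Λ'" := Lambda.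

HB.instance Definition _ := [isSub for Lambda_val].
HB.instance Definition _ := [Choice of Λ by <:].
HB.instance Definition _ := GRing.SubChoice_isSubComNzRing.Build
  {fraction {poly int}} laurent Λ laurent_subring_closed.

Definition Lambda_unit : {pred Λ} :=
  fun x => (val x != 0) && ((val x)^-1 \in laurent).

Definition Lambda_inv (x : Λ) : Λ := insubd x (val x)^-1.

Lemma Lambda_mulVx : {in Lambda_unit, left_inverse 1 Lambda_inv *%R}.
Proof.
move=> x /andP[x0 xV]; apply: val_inj.
by rewrite rmorphM rmorph1 /= /Lambda_inv val_insubd xV mulVf.
Qed.

Lemma Lambda_unitPl (x y : Λ) : y * x = 1 -> Lambda_unit x.
Proof.
move=> /(congr1 val); rewrite rmorphM rmorph1 /= => yx.
have x0 : val x != 0.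
  by apply: contra_eq_neq yx => ->; rewrite mulr0 eq_sym oner_neq0.
by rewrite /Lambda_unit x0 /= -(mul1r (val x)^-1) -yx mulfK //; apply: valP.
Qed.

Lemma Lambda_inv_out : {in [predC Lambda_unit], Lambda_inv =1 id}.
Proof.
move=> x; rewrite inE /= /Lambda_inv /in_mem /= /Lambda_unit negb_and negbK.
move=> xU; apply: val_inj; rewrite val_insubd.
case: ifPn => // xV; move: xU; rewrite xV orbF => /eqP /= x0.
by rewrite x0 invr0.
Qed.

HB.instance Definition _ := GRing.ComNzRing_hasMulInverse.Build Λ
  Lambda_mulVx Lambda_unitPl Lambda_inv_out.

Definition Lambda_t : Λ := MkLambda (tofrac_laurent 'X).

Local Notation t := Lambda_t.

Section Submodule.
Variables (R : nzRingType) (V : lmodType R).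

Definition is_submodule (W : set V) : Prop :=
  W 0 /\ forall (a : R) (u v : V), W u -> W v -> W (a *: u + v).

Definition submod_span (G : set V) : set V := smallest is_submodule G.

Lemma submod_span_closed (G : set V) : is_submodule (submod_span G).
Proof.
split=> [W [[W0 _] _] //|a u v Gu Gv W WG].
by case: (WG) => -[_ Wl] _; apply: Wl; [apply: Gu|apply: Gv].
Qed.

Definition in_submod_span (G : set V) : {pred V} :=
  fun v => `[< submod_span G v >].

Lemma in_submod_span_closed (G : set V) : subsemimod_closed (in_submod_span G).
Proof.
have [S0 Sl] := submod_span_closed G; split; first split.
- exact/asboolP.
- move=> u v /asboolP Gu /asboolP Gv; apply/asboolP.
  by rewrite -[u]scale1r; apply: Sl.
- move=> a u /asboolP Gu; apply/asboolP.
  by rewrite -[_ *: _]addr0; apply: Sl.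
Qed.

HB.instance Definition _ (G : set V) :=
  GRing.isSubmodClosed.Build R V (in_submod_span G) (in_submod_span_closed G).

End Submodule.

Section QuotientModule.
Variables (R : nzRingType) (V : lmodType R) (G : set V).
Local Notation S := (in_submod_span G).

Local Notation quotS := (@Quotient.quot V S).

(* The quotient module V / submod_span G *)
Definition quot_mod : Type := quotS.

HB.instance Definition _ := GRing.Zmodule.copy quot_mod quotS.

Definition quot_proj (v : V) : quot_mod := \pi_quotS v.

Lemma quot_projB : zmod_morphism quot_proj.
Proof. exact: (raddfB \pi_quotS). Qed.

HB.instance Definition _ :=
  GRing.isZmodMorphism.Build V quot_mod quot_proj quot_projB.

Lemma quot_projP u v : reflect (quot_proj u = quot_proj v) (u - v \in S).
Proof. by rewrite Quotient.idealrBE; apply: eqP. Qed.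

Lemma quot_proj_repr (x : quot_mod) : quot_proj (repr (x : quotS)) = x.
Proof. exact: reprK. Qed.

Definition quot_scale (a : R) (x : quot_mod) : quot_mod :=
  quot_proj (a *: repr (x : quotS)).

Lemma quot_proj_scale a v : quot_proj (a *: v) = quot_scale a (quot_proj v).
Proof.
by apply/quot_projP; rewrite -scalerBr rpredZ //; apply/quot_projP;
  rewrite quot_proj_repr.
Qed.

Lemma quot_scaleA a b x : quot_scale a (quot_scale b x) = quot_scale (a * b) x.
Proof. by rewrite -[x]quot_proj_repr -!quot_proj_scale scalerA. Qed.

Lemma quot_scale1 : left_id 1 quot_scale.
Proof. by move=> x; rewrite -[x]quot_proj_repr -quot_proj_scale scale1r. Qed.

Lemma quot_scaleDr : right_distributive quot_scale +%R.
Proof.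
move=> a x y; rewrite -[x]quot_proj_repr -[y]quot_proj_repr.
by rewrite -raddfD -!quot_proj_scale scalerDr raddfD.
Qed.

Lemma quot_scaleDl x : {morph quot_scale^~ x : a b / a + b}.
Proof.
move=> a b; rewrite -[x]quot_proj_repr -!quot_proj_scale.
by rewrite scalerDl raddfD.
Qed.

HB.instance Definition _ := GRing.Zmodule_isLmodule.Build R quot_mod
  quot_scaleA quot_scale1 quot_scaleDr quot_scaleDl.

HB.instance Definition _ :=
  GRing.isScalable.Build R V quot_mod *:%R quot_proj quot_proj_scale.

End QuotientModule.

(* Equality of A and B as quotients of U: an isomorphism commuting with the
   epimorphisms phi and psi. *)
Definition same_quotient (R : nzRingType) (U A B : lmodType R)
    (phi : U -> A) (psi : U -> B) : Prop :=
  exists f : {linear A -> B}, bijective f /\ forall u, f (phi u) = psi u.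

(* A is the internal direct sum of the images of the A_ i under iota; the
   projection on the i-th summand is pi i.  The family may be infinite. *)
Record is_direct_sum (R : nzRingType) (A : lmodType R) (I : choiceType)
    (A_ : I -> lmodType R) (iota : forall i, {linear A_ i -> A})
    (pi : forall i, {linear A -> A_ i}) : Prop := IsDirectSum {
  dsum_pi_iota : forall i x, pi i (iota i x) = x;
  dsum_pi_iota_neq : forall i j x, i != j -> pi j (iota i x) = 0;
  dsum_finite_support : forall a, finite_set [set i | pi i a != 0];
  dsum_sum : forall a, a = \sum_(i \in [set: I]) iota i (pi i a)
}.

Section Ideals.
Variable R : comNzRingType.

Definition is_ideal (I : set R) : Prop := is_submodule (I : set R^o).

Definition maximal_ideal (m : set R) : Prop :=
  [/\ is_ideal m, m <> setT &
      forall I : set R, is_ideal I -> m `<=` I -> I = m \/ I = setT].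

Definition ideal_mul (I J : set R) : set R :=
  submod_span ([set x * y | x in I & y in J] : set R^o).

Definition ideal_exp (I : set R) (n : nat) : set R :=
  iter n (ideal_mul I) setT.

Definition local_at (m : set R) (A : lmodType R) : Prop :=
  (exists a : A, a != 0) /\
  exists N, forall n, (N <= n)%N ->
    forall (x : R) (a : A), ideal_exp m n x -> x *: a = 0.

End Ideals.

Definition is_subgroup (G : set 'M[Λ]_2) : Prop :=
  [/\ forall g, G g -> g \in unitmx,
      G 1%:M,
      forall g h, G g -> G h -> G (g *m h) &
      forall g, G g -> G (invmx g)].

Definition mx2 (a b c d : Λ) : 'M[Λ]_2 :=
  \matrix_(i, j) if i == 0 then (if j == 0 then a else b)
                 else (if j == 0 then c else d).

Definition XX : 'M[Λ]_2 := mx2 0 (- t) t (- t).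
Definition YY : 'M[Λ]_2 := mx2 0 (- t) (- t ^+ 2) 0.

Definition Bu3 : set 'M[Λ]_2 := smallest is_subgroup [set XX; YY; t%:M].

(* The set of left cosets of K in G is finite; meant for K a subgroup of G. *)
Definition finite_index (K G : set 'M[Λ]_2) : Prop :=
  finite_set [set [set g *m k | k in K] | g in G].

(* Generators of the submodule V(H), so that AH H is Lambda^2 / V(H). *)
Definition V_gens (H : set 'M[Λ]_2) : set 'cV[Λ]_2 :=
  [set (h - 1%:M) *m u | h in H & u in [set: 'cV[Λ]_2]].

Definition AH (H : set 'M[Λ]_2) : lmodType Λ := quot_mod (V_gens H).

Definition projAH (H : set 'M[Λ]_2) : {linear 'cV[Λ]_2 -> AH H} :=
  @quot_proj Λ 'cV[Λ]_2 (V_gens H).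

(* Only the kernel of phi matters; phi is a bare function so that composites
   apply directly. *)
Definition HA (A : lmodType Λ) (phi : 'cV[Λ]_2 -> A) : set 'M[Λ]_2 :=
  [set h | Bu3 h /\
    [set (h - 1%:M) *m u | u in [set: 'cV[Λ]_2]] `<=` phi @^-1` [set 0]].

(* Main.v *)
From HB Require Import structures.
Require Import Defs.
From mathcomp Require Import all_boot all_order all_algebra.
From mathcomp Require Import boolp classical_sets cardinality fsbigop.
From mathcomp Require Import zify.

Set Implicit Arguments.
Unset Strict Implicit.
Unset Printing Implicit Defensive.

Import GRing.Theory.
Local Open Scope ring_scope.
Local Open Scope classical_set_scope.

(** A subgroup [H] is contained in [H(phi)] if and only if [V(H)] is contained
    in the kernel of [phi]: a Galois connection between sets of matrices in
    [Bu_3] and submodules of [Λ^2].  The identities between [H], [H(A(H))] and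
    [H(A)] are its formal consequences.  That [H(A)] is the intersection of the
    [H(A_i)] holds because an element of a direct sum vanishes if and only if
    all its components do.

    The finite quotient [A'] would come from the residual finiteness of finitely
    generated [Λ]-modules, but the finite index hypothesis makes the commutative
    algebra elementary.  Two of the scalar matrices [t^k] lie in the same coset
    of [H(A)], so [t^n] acts trivially on [A] for some [n > 0], and [A] is a
    finitely generated abelian group, spanned by the classes of [t^i e_j] for
    [i < n] ([Lambda_fg_zmodule]).  Such a group is residually finite, even
    through its quotients [A / N A] ([fg_residually_finite]): a nonzero [a] is
    avoided by some [N A], because modulo a subgroup maximal among those
    avoiding [a] every element is torsion.  The quotients [A / N A] are
    [Λ]-modules and are finite for [N > 0] ([fg_finite_mod]).  Whether a matrix
    acts trivially on [A] or on [A / N A] depends only on its coset modulo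
    [H(A)]; so each of the finitely many cosets other than [H(A)] is excluded by
    one [N], and [A'] is [A / N A] for the product [N] of these numbers.

    The decomposition into local modules exists for a finite module over any
    commutative ring [R].  By pigeonhole every [x] in [R] has a power acting on
    [A] as an idempotent, and [R] acts through finitely many maps.  Multiplying
    out the product of [r + (1 - r)] over representatives [r] of all idempotent
    actions writes [1] as a sum of orthogonal idempotents [e_i] such that every
    idempotent action is [0] or [1] on each [e_i A] ([primitive_idempotents]).
    Hence each [x] is nilpotent or invertible on a nonzero [e_i A], the
    nilpotent ones form a maximal ideal [m_i] ([nil_on_maximal]), and [e_i A] is
    [m_i]-local ([nil_on_local]).  These ideals are distinct because [e_i] lies
    in [m_j] for [j] other than [i], but not in [m_i]. *)

(** * Counting, submodules and quotients *)

Lemma pigeonhole_nat (T : Type) (f : nat -> T) :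
  finite_set (range f) -> exists i j, (i < j)%N /\ f i = f j.
Proof.
move=> finf; apply: contrapT => nf; apply: infinite_nat.
suff injf : {in [set: nat] &, injective f}.
  by have /eq_finite_set <- := inj_card_eq injf.
move=> i j _ _ fij; apply: contrapT => /eqP; rewrite neq_ltn => /orP[] ltij.
  by apply: nf; exists i, j.
by apply: nf; exists j, i.
Qed.

Lemma count_lt (T : eqType) (p q : pred T) (s : seq T) x :
  {subset p <= q} -> x \in s -> q x -> ~~ p x -> (count p s < count q s)%N.
Proof.
move=> pq + qx px; elim: s => //= y s IHs; rewrite in_cons => /predU1P[<-|xs].
  by rewrite (negPf px) qx add0n add1n ltnS sub_count.
by rewrite -addnS leq_add ?IHs//; have := pq y; rewrite !unfold_in; case: (p y) => // ->.
Qed.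

Section Quotients.
Variables (R : nzRingType) (V : lmodType R).

Lemma submod_span_id (G : set V) : is_submodule G -> submod_span G = G.
Proof. exact: smallest_id. Qed.

Lemma in_spanP (G : set V) v : (v \in in_submod_span G) <-> submod_span G v.
Proof. by split=> [/asboolP|h]; last apply/asboolP. Qed.

Lemma quot_proj_eq0 (G : set V) v : quot_proj G v = 0 <-> submod_span G v.
Proof.
rewrite -(raddf0 (quot_proj G)) -(in_spanP G); split.
- by move=> /quot_projP; rewrite subr0.
- by move=> h; apply/quot_projP; rewrite subr0.
Qed.

Lemma quot_proj_surj (G : set V) : range (quot_proj G) = [set: quot_mod G].
Proof. by apply/seteqP; split=> // x _; exists (repr x); rewrite ?quot_proj_repr. Qed.

Lemma linear_ker_submodule (W : lmodType R) (f : {linear V -> W}) :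
  is_submodule [set v | f v = 0].
Proof.
by split=> [|a u v /= fu fv]; rewrite /= ?linear0// linearP fu fv scaler0 addr0.
Qed.

Lemma quot_lift (G : set V) (W : lmodType R) (f : {linear V -> W}) :
  (forall v, G v -> f v = 0) ->
  exists g : {linear quot_mod G -> W}, forall v, g (quot_proj G v) = f v.
Proof.
move=> fG.
have fspan v : submod_span G v -> f v = 0.
  by move=> /(_ [set v | f v = 0]); apply; split=> //; apply: linear_ker_submodule.
pose g (x : quot_mod G) := f (repr x).
have gE v : g (quot_proj G v) = f v.
  apply/eqP; rewrite -subr_eq0 /g -raddfB; apply/eqP/fspan/in_spanP/quot_projP.
  exact: quot_proj_repr.
have g_lin : linear g.
  move=> a x y; rewrite -[x]quot_proj_repr -[y]quot_proj_repr -linearP !gE.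
  exact: linearP.
pose gL := GRing.isLinear.Build _ _ _ _ g g_lin.
pose g' : {linear quot_mod G -> W} := HB.pack g gL.
by exists g'.
Qed.

End Quotients.

(** * Modules on which every scalar is nilpotent or invertible *)

Section Local.
Variables (R : comNzRingType) (A : lmodType R).

Definition nil_on (x : R) := exists k, forall a : A, x ^+ k *: a = 0.
Definition unit_on (x : R) := exists z, forall a : A, z *: (x *: a) = a.

Hypothesis A_neq0 : exists a : A, a != 0.
Hypothesis nilVunit : forall x, nil_on x \/ unit_on x.

Lemma nil_onM x y : nil_on y -> nil_on (x * y).
Proof. by case=> k yk; exists k => a; rewrite exprMn -scalerA yk scaler0. Qed.

Lemma nil_not_unit x : nil_on x -> ~ unit_on x.
Proof.
case=> k xk [z zx]; case: A_neq0 => a /eqP; apply.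
have zxk n (b : A) : (z * x) ^+ n *: b = b.
  elim: n => [|n IHn]; first by rewrite expr0 scale1r.
  by rewrite exprS -scalerA IHn -scalerA zx.
by rewrite -(zxk k a) exprMn -scalerA xk scaler0.
Qed.

Lemma nil_onD x y : nil_on x -> nil_on y -> nil_on (x + y).
Proof.
move=> [k xk] [l yl]; exists (k + l)%N => a.
rewrite exprDn scaler_suml big1// => i _; rewrite -scalerMnl.
have [ki|/ltnW ik] := leqP l i.
  by rewrite -(subnK ki) exprD mulrA -scalerA yl scaler0 mul0rn.
have -> : (k + l - i = (l - i) + k)%N by rewrite -addnBA 1?addnC.
by rewrite exprD mulrAC -scalerA xk scaler0 mul0rn.
Qed.

(** An ideal strictly larger than [nil_on] contains some [x] with [z x] acting
    as the identity; then [1 - z x] acts as [0], hence is in the ideal too. *)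
Lemma nil_on_maximal : maximal_ideal nil_on.
Proof.
have nil0 : nil_on 0 by exists 1%N => a; rewrite expr1 scale0r.
split.
- split=> [//|a u v nu nv]; apply: nil_onD => //; exact: nil_onM.
- move=> nilT; suff: nil_on 1.
    by move/nil_not_unit; apply; exists 1 => a; rewrite !scale1r.
  by rewrite nilT.
- move=> I [I0 ID] mI.
  have [ImI|/existsNP[x /not_implyP[Ix nx]]] := pselect (I `<=` nil_on).
    by left; apply/seteqP.
  right; apply/seteqP; split=> // r _.
  case: (nilVunit x) => // -[z zx].
  have I1 : I 1.
    rewrite -(subrK (z * x) 1) addrC; apply: (ID z x) => //; apply: mI.
    by exists 1%N => a; rewrite expr1 scalerBl -scalerA zx scale1r subrr.
  by rewrite -[r]mulr1 -[r * 1]addr0; apply: (ID r 1).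
Qed.

Hypothesis A_fin : finite_set [set: A].

(** If [y] is nilpotent on [A] and [y b] is nonzero, then the orbit [R y b] is
    strictly smaller than [R b]: from [b = r y b] would follow [b = (r y)^k b]
    for all [k].  So a product of as many nilpotent scalars as [A] has elements
    kills every [b]. *)
Lemma nil_on_local : local_at nil_on A.
Proof.
split=> //; have /finite_seqP[s sA] := A_fin.
have sT a : a \in s by have : [set: A] a by []; rewrite sA.
pose orb (b : A) : pred A := fun a => `[< exists r, a = r *: b >].
exists (size s) => n sn x b.
suff: forall c, (count (orb c) s <= n)%N ->
    forall y, ideal_exp nil_on n y -> y *: c = 0.
  by apply; apply: leq_trans sn; apply: count_size.
elim: n {sn x b} => [|n IHn] b bn x.
  suff : (0 < count (orb b) s)%N by rewrite lt0n; move: bn; rewrite leqn0 => ->.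
  rewrite -has_count; apply/hasP; exists b => //.
  by apply/asboolP; exists 1; rewrite scale1r.
move=> mx; apply: (mx [set x | x *: b = 0]); split.
  split=> [|a u v /= ub vb]; rewrite /= ?scale0r// scalerDl -scalerA.
  by rewrite ub vb scaler0 addr0.
move=> _ [y my [z mz <-]] /=; rewrite mulrC -scalerA.
have [->|yb0] := eqVneq (y *: b) 0; first by rewrite scaler0.
apply: IHn mz; rewrite -ltnS; apply: leq_trans bn.
have sub : {subset orb (y *: b) <= orb b}.
  by move=> a /asboolP[r ->]; apply/asboolP; exists (r * y); rewrite scalerA.
have nb : ~~ orb (y *: b) b.
  apply/asboolPn => -[r br]; case: (nil_onM r my) => k ryk.
  move/eqP: yb0; apply; suff -> : b = 0 by rewrite scaler0.
  rewrite -(ryk b); elim: k {ryk} => [|k IHk]; first by rewrite scale1r.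
  by rewrite exprSr -scalerA -scalerA -br.
apply: (count_lt sub (sT b)) => //.
by apply/asboolP; exists 1; rewrite scale1r.
Qed.

End Local.

(** * Decomposition of a finite module by idempotents *)

Section IdempotentDecomposition.
Variables (R : comNzRingType) (A : lmodType R).

Definition idem_on (x : R) := forall a : A, x *: (x *: a) = x *: a.

Lemma orthogonal_idem n (e : 'I_n -> R) :
  (forall i j (a : A), i != j -> e i *: (e j *: a) = 0) ->
  (forall a : A, \sum_i e i *: a = a) -> forall i, idem_on (e i).
Proof.
move=> e_orth e_sum i a; rewrite -[in RHS](e_sum a) scaler_sumr (bigD1 i)//=.
by rewrite big1 ?addr0// => j ji; rewrite e_orth// eq_sym.
Qed.

(** The summand [e_i A] is encoded as the quotient of [A] by the kernel of
    [e_i]; multiplication by [e_i] embeds it back into [A]. *)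
Lemma orthogonal_direct_sum n (e : 'I_n -> R) :
  (forall i j (a : A), i != j -> e i *: (e j *: a) = 0) ->
  (forall a : A, \sum_i e i *: a = a) ->
  exists iota : forall i, {linear quot_mod [set a : A | e i *: a = 0] -> A},
    is_direct_sum iota (fun i => @quot_proj R A [set a : A | e i *: a = 0]).
Proof.
move=> e_orth e_sum.
have ker_sub i : is_submodule [set a : A | e i *: a = 0].
  exact: (linear_ker_submodule ( *:%R (e i) : {linear A -> A})).
have lift i := cid (quot_lift
  (f := *:%R (e i) : {linear A -> A}) (G := [set a | e i *: a = 0]) (fun _ h => h)).
exists (fun i => sval (lift i)).
have iotaE i a : sval (lift i) (quot_proj [set a : A | e i *: a = 0] a) = e i *: a.
  exact: (svalP (lift i)).
have e_idem := orthogonal_idem e_orth e_sum.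
split.
- move=> i x; rewrite -[x]quot_proj_repr iotaE; apply/quot_projP/in_spanP.
  by rewrite submod_span_id//= scalerBr e_idem subrr.
- move=> i j x ij; rewrite -[x]quot_proj_repr iotaE; apply/quot_proj_eq0.
  by rewrite submod_span_id//= e_orth// eq_sym.
- by move=> a; apply: finite_finset.
- move=> a; rewrite (_ : [set: 'I_n] = [set` index_enum 'I_n]).
    rewrite -fsbig_seq ?index_enum_uniq// -[LHS](e_sum a).
    by apply: eq_bigr => i _; rewrite iotaE.
  by apply/seteqP; split=> // i _; rewrite /= mem_index_enum.
Qed.

Hypothesis A_fin : finite_set [set: A].

(** The type [F] stands for the finite set of maps [A -> A] given by scalars;
    being a finite type, it can index sums and products. *)
Lemma finite_action : exists (F : finType) (sig : R -> F),
  forall x y, sig x = sig y -> forall a : A, x *: a = y *: a.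
Proof.
have /finite_seqP[s sA] := A_fin.
have sT a : a \in s by have : [set: A] a by []; rewrite sA.
exists {ffun 'I_(size s) -> 'I_(size s).+1}.
exists (fun x => [ffun i : 'I_(size s) => inord (index (x *: nth 0 s i) s)]).
move=> x y /ffunP xy a; have /(nthP 0)[i si <-] := sT a.
have /(congr1 val) := xy (Ordinal si).
rewrite !ffunE /= !inordK ?ltnS ?index_size//.
by move=> /(congr1 (nth 0 s)); rewrite !nth_index.
Qed.

(** The powers of [x] are eventually periodic, say with period [p] from the
    exponent [i] on; then [x^n] is idempotent for any multiple [n] of [p] with
    [n >= i]. *)
Lemma idem_on_power x : exists2 n, (0 < n)%N & idem_on (x ^+ n).
Proof.
have [F [sig sigP]] := finite_action.
have [i [j [ij /sigP xij]]] :
  exists i j, (i < j)%N /\ sig (x ^+ i) = sig (x ^+ j).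
  by apply: (pigeonhole_nat (f := fun k => sig (x ^+ k))); apply: finite_finset.
pose p := (j - i)%N.
have p0 : (0 < p)%N by rewrite subn_gt0.
have ipj : (i + p = j)%N by rewrite subnKC// ltnW.
have per q m (a : A) : x ^+ (q + i + m * p) *: a = x ^+ (q + i) *: a.
  elim: m => [|m IHm]; first by rewrite addn0.
  rewrite -IHm mulSn addnA -(addnA q) ipj ![(q + _ + m * p)%N]addnAC.
  by rewrite !exprD -!scalerA xij.
exists (p * i.+1)%N; first by rewrite muln_gt0 p0.
have le_i : (i <= p * i.+1)%N by apply: (leq_trans (leqnSn i)); rewrite leq_pmull.
by move=> a; rewrite scalerA -exprD {2}mulnC -(subnK le_i) per.
Qed.

(** The [e_S] are the terms of the expansion of the product of [r + (1 - r)]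
    over representatives [r] of the idempotent actions, one for each choice [S]
    of [r] or [1 - r] in every factor.  Many of them may act as [0]. *)
Lemma primitive_idempotents : exists (I : finType) (e : I -> R),
  [/\ \sum_i e i = 1,
      forall i j (a : A), i != j -> e i *: (e j *: a) = 0 &
      forall x i, idem_on x -> (forall a : A, e i *: (x *: a) = 0) \/
                               (forall a : A, e i *: (x *: a) = e i *: a)].
Proof.
have [F [sig sigP]] := finite_action.
(* The value [0] at the other [f] keeps all [r f] idempotent. *)
have /choice[r rP] : forall f, exists x, idem_on x /\
    ((exists y, idem_on y /\ sig y = f) -> sig x = f).
  move=> f; have [[y [iy yf]]|nf] := pselect (exists y, idem_on y /\ sig y = f).
    by exists y.
  by exists 0; split=> // a; rewrite !scale0r.
pose c (S : {ffun F -> bool}) f := if S f then r f else 1 - r f.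
pose e S := \prod_f c S f.
have ec S f : exists y, e S = y * c S f.
  by rewrite /e (bigD1 f)//= mulrC; eexists.
have er S f (a : A) : e S *: (r f *: a) = if S f then e S *: a else 0.
  have [y ->] := ec S f; rewrite /c -!scalerA; have [ir _] := rP f.
  case: (S f); first by rewrite ir.
  by rewrite scalerBl scale1r ir subrr scaler0.
have ecS S S' f (a : A) : e S *: (c S' f *: a) = if S f == S' f then e S *: a else 0.
  rewrite /c; case: (S' f); first by rewrite er eqb_id.
  by rewrite scalerBl scale1r scalerBr er eqbF_neg; case: (S f); rewrite /= ?subrr ?subr0.
exists {ffun F -> bool}, e; split.
- rewrite /e -(bigA_distr_bigA (fun f b => if b then r f else 1 - r f)).
  by rewrite big1// => f _; rewrite big_bool /= addrC subrK.
- move=> S S' a SS'; have [f Sf] : exists f, S f != S' f.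
    apply: contrapT => nf; move/eqP: SS'; apply; apply/ffunP => f.
    by apply/eqP; apply: contrapT => /negP Sf; apply: nf; exists f.
  have [y ->] := ec S' f.
  by rewrite mulrC -scalerA ecS (negPf Sf).
- move=> x S ix; have [_ /(_ (ex_intro _ x (conj ix erefl)))/sigP rx] := rP (sig x).
  case Sx : (S (sig x)); [right|left] => a; by rewrite -rx er Sx.
Qed.

Theorem finite_module_local_decomposition :
  exists (n : nat) (m : 'I_n -> set R) (A_ : 'I_n -> lmodType R)
         (iota : forall i, {linear A_ i -> A}) (pi : forall i, {linear A -> A_ i}),
    [/\ injective m, forall i, maximal_ideal (m i),
        forall i, local_at (m i) (A_ i) & is_direct_sum iota pi].
Proof.
have [I [e [e_sum e_orth e_prim]]] := primitive_idempotents.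
(* A local module is nonzero, so the idempotents acting as [0] are discarded. *)
pose P : pred I := fun i => `[< exists a : A, e i *: a != 0 >].
pose e' (i : 'I_#|P|) := e (enum_val i).
have e'_orth i j (a : A) : i != j -> e' i *: (e' j *: a) = 0.
  by move=> ij; apply: e_orth; apply: contra ij => /eqP/enum_val_inj->.
have e'_sum (a : A) : \sum_i e' i *: a = a.
  rewrite -(big_enum_val (fun i => e i *: a)) -[RHS]scale1r -e_sum scaler_suml.
  rewrite [RHS](bigID P) /= [X in _ + X]big1 ?addr0// => i /asboolPn nP.
  by apply: contrapT => /eqP ea; apply: nP; exists a.
have [iota iotaP] := orthogonal_direct_sum e'_orth e'_sum.
pose A_ i : lmodType R := quot_mod [set a : A | e' i *: a = 0].
have proj0 i a : @quot_proj R A [set a : A | e' i *: a = 0] a = 0 <-> e' i *: a = 0.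
  rewrite quot_proj_eq0 submod_span_id//.
  exact: (linear_ker_submodule ( *:%R (e' i) : {linear A -> A})).
have A_neq0 i : exists a : A_ i, a != 0.
  have /asboolP[a ea] : P (enum_val i) by exact: (enum_valP i).
  by exists (quot_proj _ a); apply/eqP => /proj0 /eqP; apply/negP.
have A_nilVunit i x : nil_on (A_ i) x \/ unit_on (A_ i) x.
  have [n n0 xn] := idem_on_power x.
  case: (e_prim _ (enum_val i) xn) => exn; [left; exists n|right; exists (x ^+ n.-1)] => a.
    by rewrite -[a]quot_proj_repr -linearZ; apply/proj0.
  rewrite scalerA -exprSr prednK// -[a]quot_proj_repr -linearZ.
  apply/eqP; rewrite -subr_eq0 -linearB; apply/eqP/proj0.
  by rewrite scalerBr /e' exn subrr.
have A_fin' i : finite_set [set: A_ i].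
  by rewrite -quot_proj_surj; apply: finite_image.
exists #|P|, (fun i => nil_on (A_ i)), A_, iota, (fun i => quot_proj _).
split=> //.
- move=> i j mij; apply: contrapT => /eqP ij.
  have ei_j : nil_on (A_ j) (e' i).
    exists 1%N => a; rewrite expr1 -[a]quot_proj_repr -linearZ; apply/proj0.
    by rewrite e'_orth// eq_sym.
  have : nil_on (A_ i) (e' i) by rewrite mij.
  move=> /(nil_not_unit (A_neq0 i)); apply; exists 1 => a.
  rewrite scale1r -[a]quot_proj_repr -linearZ.
  apply/eqP; rewrite -subr_eq0 -linearB; apply/eqP/proj0.
  by rewrite scalerBr (orthogonal_idem e'_orth e'_sum) subrr.
- by move=> i; apply: nil_on_maximal.
- by move=> i; apply: nil_on_local.
Qed.

End IdempotentDecomposition.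

(** * Finitely generated abelian groups *)

Section ResidualFiniteness.
Variable A : zmodType.

Definition is_zsubgroup (K : set A) :=
  K 0 /\ forall x y, K x -> K y -> K (x - y).

Lemma zsubgroupD K x y : is_zsubgroup K -> K x -> K y -> K (x + y).
Proof.
by move=> [K0 KB] Kx Ky; rewrite -[y]opprK -(sub0r y); apply/KB/KB.
Qed.

Lemma zsubgroupMn K x n : is_zsubgroup K -> K x -> K (x *+ n).
Proof.
move=> KS Kx; elim: n => [|n IHn]; first by case: KS.
by rewrite mulrS; apply: zsubgroupD.
Qed.

Lemma zsubgroupMz K x (z : int) : is_zsubgroup K -> K x -> K (x *~ z).
Proof.
move=> KS Kx; case: (intP z) => [|n|n]; first by case: KS.
- exact: zsubgroupMn.
- by rewrite mulrNz -[- _]sub0r; apply: (proj2 KS); [case: KS|apply: zsubgroupMn].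
Qed.

Lemma zsubgroup_abszMn K x (z : int) :
  is_zsubgroup K -> K (x *~ z) -> K (x *+ `|z|%N).
Proof. by move=> KS /(zsubgroupMz (sgz z) KS); rewrite -mulrzA mulrC -abszEsg. Qed.

(** Zorn's lemma provides [K]; the last clause is the form in which maximality is
    used, namely that [a] lies in [K + Z b]. *)
Lemma maximal_avoiding (a : A) : a != 0 ->
  exists K, [/\ is_zsubgroup K, ~ K a &
    forall b, ~ K b -> exists z : int, K (a - b *~ z)].
Proof.
move=> /eqP a0.
(* [P] allows the empty set, which is the union of the empty chain. *)
pose P (X : set A) := (forall x y, X x -> X y -> X (x - y)) /\ ~ X a.
have [F FP Ftot|K [[KB Ka] Kmax]] := @Zorn_bigcup A P.
  split=> [x y [X FX Xx] [Y FY Yy]|[X FX]]; last by have [] := FP _ FX.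
  have [XY|YX] := Ftot _ _ FX FY.
  - by exists Y => //; apply: (FP _ FY).1 => //; apply: XY.
  - by exists X => //; apply: (FP _ FX).1 => //; apply: YX.
have K0 : K 0.
  have [[x Kx]|Kempty] := pselect (K !=set0); first by rewrite -(subrr x); apply: KB.
  have /Kmax[] : K `<` [set 0].
    by split=> [x Kx|/(_ 0 erefl) K0]; case: Kempty; [exists x|exists 0].
  by split=> [x y -> ->|a00]; [rewrite /= subrr|apply: a0].
have KS : is_zsubgroup K by [].
exists K; split=> // b Kb; apply: contrapT => nz.
have /Kmax[] : K `<` [set x | exists z : int, K (x - b *~ z)].
  split=> [x Kx|/(_ b) bK]; first by exists 0; rewrite mulr0z subr0.
  by apply/Kb/bK; exists 1; rewrite mulr1z subrr.
split=> // x y [z Kz] [w Kw]; exists (z - w).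
rewrite mulrzBr opprB (addrC (b *~ w)) addrACA (addrC (- y)) -(opprB y).
exact: KB.
Qed.

(** Let [K] be maximal among the subgroups that avoid [a].  For [b] outside [K]
    the subgroup [K + Z b] contains [a], so [a] is a multiple of [b] modulo [K],
    and not the zero multiple.  With [b = 2 a] this shows that [a] is torsion
    modulo [K], and then that every [b] is.  The generators have a common
    exponent [N], so [N A] is contained in [K] and avoids [a]. *)
Lemma fg_residually_finite (s : seq A) (a : A) :
  (forall K, is_zsubgroup K -> (forall x, x \in s -> K x) -> forall x, K x) ->
  a != 0 -> exists2 N, (0 < N)%N & forall b, a != b *+ N.
Proof.
move=> s_gen /maximal_avoiding[K [KS Ka Kmax]].
have [Na Na0 KNa] : exists2 N, (0 < N)%N & K (a *+ N).
  have [Ka2|/Kmax[z]] := pselect (K (a *+ 2)); first by exists 2.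
  rewrite -[X in X - _]mulr1z pmulrn -mulrzA -mulrzBr => /(zsubgroup_abszMn KS).
  by exists `|(1 - 2 * z)%R|%N => //; rewrite absz_gt0; lia.
have tors b : exists2 N, (0 < N)%N & K (b *+ N).
  have [Kb|/Kmax[z Kz]] := pselect (K b); first by exists 1%N.
  have z0 : z != 0 by apply/eqP => z0; apply: Ka; move: Kz; rewrite z0 mulr0z subr0.
  exists `|(z * Na)%R|%N; first by rewrite absz_gt0 mulf_neq0// -lt0n.
  apply: zsubgroup_abszMn => //.
  rewrite mulrzA -pmulrn -[_ *+ _](subKr (a *+ Na)) -mulrnBl.
  by apply: (proj2 KS) => //; apply: zsubgroupMn.
have [N N0 KN] : exists2 N, (0 < N)%N & forall x, x \in s -> K (x *+ N).
  elim: (s) => [|x r [N N0 IHr]]; first by exists 1%N.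
  have [M M0 KM] := tors x; exists (M * N)%N; first by rewrite muln_gt0 M0.
  move=> y; rewrite in_cons => /predU1P[->|/IHr Ky].
    by rewrite mulrnA; apply: zsubgroupMn.
  by rewrite mulnC mulrnA; apply: zsubgroupMn.
exists N => // b; apply: contra_notN Ka => /eqP ->.
apply: (s_gen [set b | K (b *+ N)]) => //.
split=> [|x y /= Kx Ky]; first by rewrite /= mul0rn; case: KS.
by rewrite /= mulrnBl; apply: (proj2 KS).
Qed.

End ResidualFiniteness.

Section QuotientModN.
Variables (R : nzRingType) (A : lmodType R).

Definition multiples (N : nat) : set A := [set b *+ N | b in [set: A]].

Lemma multiples_submodule N : is_submodule (multiples N).
Proof.
split; first by exists 0; rewrite ?mul0rn.
move=> a _ _ [u _ <-] [v _ <-]; exists (a *: u + v) => //.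
by rewrite mulrnDl scalerMnr.
Qed.

(** Only the residues modulo [N] of the coefficients of the generators matter. *)
Lemma fg_finite_mod (s : seq A) N : (0 < N)%N ->
  (forall K, is_zsubgroup K -> (forall x, x \in s -> K x) -> forall x, K x) ->
  finite_set [set: quot_mod (multiples N)].
Proof.
case: N => // N _ s_gen.
pose pr : {linear A -> quot_mod (multiples N.+1)} := @quot_proj R A (multiples N.+1).
have prN x : pr x *+ N.+1 = 0.
  rewrite -raddfMn; apply/quot_proj_eq0; rewrite submod_span_id.
    by exists x.
  exact: multiples_submodule.
pose S (f : 'I_(size s) -> nat) := \sum_(i < size s) pr s`_i *+ f i.
have prS x : exists f, pr x = S f.
  apply: (s_gen [set x | exists f, pr x = S f]).
    split=> [|y z /= [f yf] [g zg]].
      by exists (fun=> 0%N); rewrite raddf0 /S big1// => i _; rewrite mulr0n.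
    (* The factor [N] is [-1] modulo [N.+1]. *)
    exists (fun i => f i + g i * N)%N; rewrite raddfB /= yf zg /S -sumrB.
    apply: eq_bigr => i _; rewrite mulrnDr; congr (_ + _).
    apply/eqP; rewrite eq_sym -addr_eq0 -mulrnDr; apply/eqP.
    by rewrite -mulnSr mulnC mulrnA prN mul0rn.
  move=> y /(nthP 0)[i si <-]; exists (fun j => (j == Ordinal si) : nat).
  rewrite /S (bigD1 (Ordinal si))//= eqxx mulr1n big1 ?addr0// => j /negPf ->.
  by rewrite mulr0n.
have <- : range (fun f : {ffun 'I_(size s) -> 'I_N.+1} => S (fun i => f i)) =
    [set: quot_mod (multiples N.+1)].
  apply/seteqP; split=> // x _; have := quot_proj_surj (multiples N.+1).
  move=> /seteqP[_ /(_ x I)] [y _ <-]; have [f ->] := prS y.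
  exists [ffun i => inord (f i %% N.+1)] => //; apply: eq_bigr => i _.
  rewrite ffunE inordK ?ltn_mod// [in RHS](divn_eq (f i) N.+1).
  by rewrite mulrnDr mulnC mulrnA prN mul0rn add0r.
by apply: finite_image; apply: finite_finset.
Qed.

End QuotientModN.

Arguments multiples {R} A N.

(** * Modules over the Laurent polynomial ring *)

Local Notation t := Lambda_t.

Lemma Lambda_tVt : exists s : Λ, s * t = 1.
Proof.
have tV : (tofrac 'X)^-1 \in laurent.
  by apply/asboolP; exists 1, 1%N; rewrite expr1 tofrac1 mul1r.
exists (MkLambda tV); apply: val_inj; rewrite rmorphM rmorph1 /=.
by rewrite mulVf// -[tofrac _]expr1 fracX_neq0.
Qed.

(** The descent from [t * x] to [x] reaches the negative powers of [t]. *)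
Lemma Lambda_rect (P : Λ -> Prop) : P 1 ->
  (forall x y, P x -> P y -> P (x - y)) ->
  (forall x, P x -> P (t * x)) -> (forall x, P (t * x) -> P x) ->
  forall x, P x.
Proof.
move=> P1 PB PM PV.
have PS : is_zsubgroup P by split=> //; rewrite -(subrr 1); apply: PB.
have Ppoly p : P (MkLambda (tofrac_laurent p)).
  elim/poly_ind: p => [|p c IHp].
    by rewrite (_ : MkLambda _ = 0); [case: PS|apply: val_inj; rewrite /= tofrac0].
  rewrite (_ : MkLambda _ = t * MkLambda (tofrac_laurent p) + c%:~R).
    by apply: (zsubgroupD PS); [apply: PM|apply: zsubgroupMz].
  apply: val_inj; transitivity (tofrac (p * 'X) + tofrac c%:P).
    exact: tofracD.
  rewrite rmorphD !rmorphM rmorph_int mulrC; congr (_ + _).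
  by rewrite -[in LHS](intz c) !rmorph_int.
case=> v vL; have /asboolP[p [n vE]] := vL.
have Ptn m x : P (t ^+ m * x) -> P x.
  by elim: m => [|m IHm]; rewrite ?expr0 ?mul1r// exprS -mulrA => /PV.
apply: (Ptn n); rewrite (_ : _ * _ = MkLambda (tofrac_laurent p)) //.
apply: val_inj; rewrite rmorphM rmorphXn /= vE mulrC divfK//; exact: fracX_neq0.
Qed.

(** A subgroup [K] containing the elements [t^i x] need not be stable under [t],
    but its largest [t]-stable subgroup [K'] contains them too; as [t^n] acts
    trivially, [K'] is also stable under division by [t], hence a submodule. *)
Lemma Lambda_fg_zmodule (A : lmodType Λ) (s : seq A) n : (0 < n)%N ->
  (forall a : A, t ^+ n *: a = a) ->
  (forall W, is_submodule W -> (forall x, x \in s -> W x) -> forall a, W a) ->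
  forall K, is_zsubgroup K ->
    (forall x, x \in [seq t ^+ i *: x | i <- iota 0 n, x <- s] -> K x) ->
    forall a, K a.
Proof.
move=> n0 tn s_gen K KS Ks.
pose K' := [set a | forall k, K (t ^+ k *: a)].
have K'S : is_zsubgroup K'.
  split=> [k|x y Kx Ky k]; first by rewrite scaler0; case: KS.
  by rewrite scalerBr; apply: (proj2 KS).
have K't a : K' a -> K' (t *: a) by move=> Ka k; rewrite scalerA -exprSr.
have K'V a : K' (t *: a) -> K' a.
  move=> Ka k; rewrite -[a]tn scalerA -exprD -(prednK n0) addnS exprSr -scalerA.
  exact: Ka.
have K'Z (r : Λ) : forall a, K' a -> K' (r *: a).
  elim/Lambda_rect: r => [a|x y Kx Ky a Ka|x Kx a Ka|x Kx a Ka].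
  - by rewrite scale1r.
  - by rewrite scalerBl; apply: (proj2 K'S); [apply: Kx|apply: Ky].
  - by rewrite -scalerA; apply/K't/Kx.
  - by apply: K'V; rewrite scalerA; apply: Kx.
move=> a; suff /(_ 0%N) : K' a by rewrite expr0 scale1r.
move: a; apply: s_gen.
  split=> [|r u v Ku Kv]; first by case: K'S.
  by apply: (zsubgroupD K'S) => //; apply: K'Z.
move=> x xs k.
have tnm m (b : A) : t ^+ (m * n) *: b = b.
  elim: m => [|m IHm]; first by rewrite scale1r.
  by rewrite mulSn exprD -scalerA IHm tn.
rewrite (divn_eq k n) exprD -scalerA tnm; apply: Ks.
by apply/allpairsP; exists (k %% n, x)%N; rewrite mem_iota /= add0n ltn_mod n0.
Qed.

Lemma colvec_generated (W : set 'cV[Λ]_2) : is_submodule W ->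
  (forall j, W (delta_mx j 0)) -> forall u, W u.
Proof.
move=> [W0 WD] We u.
rewrite [u]matrix_sum_delta; elim/big_ind: _ => //= [x y Wx Wy|i _].
  by rewrite -[x]scale1r; apply: WD.
by rewrite big_ord1 -[_ *: _]addr0; apply: WD => //; rewrite !ord1.
Qed.

(** * The groups H(A) *)

Definition fixes_mod (A : lmodType Λ) (phi : 'cV[Λ]_2 -> A) (h : 'M[Λ]_2) :=
  forall u, phi ((h - 1%:M) *m u) = 0.

Lemma HAP (A : lmodType Λ) (phi : 'cV[Λ]_2 -> A) h :
  HA phi h <-> Bu3 h /\ fixes_mod phi h.
Proof.
split=> -[Bh fh]; split=> //; first by move=> u; apply: fh; exists u.
by move=> _ [u _ <-]; apply: fh.
Qed.

Lemma fixes_modM (A : lmodType Λ) (phi : {linear 'cV[Λ]_2 -> A}) g h :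
  fixes_mod phi g -> fixes_mod phi h -> fixes_mod phi (g *m h).
Proof.
move=> fg fh u; have := fg (h *m u); have := fh u.
rewrite !mulmxBl !mul1mx !raddfB /= mulmxA => /subr0_eq <- /subr0_eq ->.
by rewrite subrr.
Qed.

Lemma Bu3_t k : Bu3 (t ^+ k)%:M.
Proof.
move=> M [[_ M1 MM _] Mgen]; elim: k => [|k IHk]; first by rewrite expr0.
by rewrite exprS scalar_mxM; apply: MM => //; apply: Mgen; right.
Qed.

Section FiniteIndex.
Variables (A : lmodType Λ) (phi : {linear 'cV[Λ]_2 -> A}).

Hypothesis phi_epi : range phi = [set: A].
Hypothesis HA_index : finite_index (HA phi) Bu3.

Let coset g : set 'M[Λ]_2 := [set g *m k | k in HA phi].

Lemma HA1 : HA phi 1%:M.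
Proof.
apply/HAP; split; first by have := Bu3_t 0; rewrite expr0.
by move=> u; rewrite subrr mul0mx raddf0.
Qed.

Lemma coset_eq g g' :
  coset g = coset g' -> exists2 k, HA phi k & g = g' *m k.
Proof.
move=> gg'; have : coset g g by exists 1%:M; rewrite ?mulmx1//; exact: HA1.
by rewrite gg' => -[k Hk <-]; exists k.
Qed.

(** Infinitely many scalar matrices [t^k] meet finitely many cosets of [H(A)],
    so [t^i] and [t^j] with [i < j] agree on [A]; as [t] is invertible in [Λ],
    the factor [t^i] can be cancelled. *)
Lemma t_power_trivial : exists2 n, (0 < n)%N & forall a : A, t ^+ n *: a = a.
Proof.
have [i [j [ij cij]]] : exists i j, (i < j)%N /\
    coset (t ^+ i)%:M = coset (t ^+ j)%:M.
  apply: (@pigeonhole_nat _ (fun k => coset (t ^+ k)%:M)).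
  apply: sub_finite_set HA_index => _ [k _ <-].
  by exists (t ^+ k)%:M => //; apply: Bu3_t.
have [k /HAP[_ fk] tij] := coset_eq (esym cij).
exists (j - i)%N; first by rewrite subn_gt0.
move=> a; have : range phi a by rewrite phi_epi.
case=> u _ <-; have [s st] := Lambda_tVt.
have tK (x : A) : s ^+ i *: (t ^+ i *: x) = x.
  by rewrite scalerA -exprMn st expr1n scale1r.
rewrite -[LHS]tK -[RHS]tK [t ^+ i *: (_ *: _)]scalerA -exprD subnKC ?(ltnW ij)//.
congr (_ *: _).
have := fk u; rewrite mulmxBl mul1mx raddfB /= => /subr0_eq ku.
have phiZ c v : c *: phi v = phi (c *: v) by rewrite linearZ.
by rewrite -[in RHS]ku !phiZ scalemxAl -!mul_scalar_mx tij.
Qed.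

Lemma finite_quotient_same_HA : exists (A' : lmodType Λ) (psi : {linear A -> A'}),
  [/\ range psi = [set: A'], finite_set [set: A'] & HA phi = HA (psi \o phi)].
Proof.
have [n n0 tn] := t_power_trivial.
pose s := [seq phi (delta_mx j 0) | j <- enum 'I_2].
have s_gen W : is_submodule W -> (forall x, x \in s -> W x) -> forall a, W a.
  move=> [W0 WD] Ws a; have : range phi a by rewrite phi_epi.
  case=> u _ <-; apply: (@colvec_generated (phi @^-1` W)) => [|j].
    by split=> [|r x y Wx Wy]; rewrite /= ?raddf0 ?linearP//; apply: WD.
  by apply: Ws; apply: map_f; rewrite mem_enum.
have z_gen := Lambda_fg_zmodule n0 tn s_gen.
pose psi N : {linear A -> quot_mod (multiples A N)} := @quot_proj Λ A (multiples A N).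
have psi0 N a : psi N a = 0 <-> multiples A N a.
  by rewrite quot_proj_eq0 submod_span_id//; apply: multiples_submodule.
(* [N] is good for the coset [C] if [A / N A] detects that [C] is not [H(A)]. *)
pose good N (C : set 'M[Λ]_2) := forall g, Bu3 g -> C = coset g ->
  fixes_mod (psi N \o phi) g -> fixes_mod phi g.
(* [A / N A] is a quotient of [A / (N M) A]. *)
have goodM N M C : good N C -> good (N * M)%N C.
  move=> gN g Bg Cg fg; apply: gN => // u; apply/psi0.
  have /psi0[b _ <-] := fg u; exists (b *+ M) => //.
  by rewrite -mulrnA mulnC.
have good1 C : exists2 N, (0 < N)%N & good N C.
  have [[g [Bg Cg nfg]]|nC] :=
      pselect (exists g, [/\ Bu3 g, C = coset g & ~ fixes_mod phi g]); last first.
    by exists 1%N => // g Bg Cg _; apply: contrapT => nfg; apply: nC; exists g.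
  have [u /eqP ugu] : exists u, phi ((g - 1%:M) *m u) <> 0 by apply/existsNP.
  (* One [g] decides for its coset, whose members act alike on [A / N A]. *)
  have [N N0 Nu] := fg_residually_finite z_gen ugu.
  exists N => // g' Bg' Cg' fg'; exfalso.
  have [k /HAP[_ fk] gk] := coset_eq (etrans (esym Cg) Cg').
  have : fixes_mod (psi N \o phi) g.
    rewrite gk; apply: (@fixes_modM _ (psi N \o phi : {linear _ -> _})) => // v /=.
    by rewrite [phi _]fk raddf0.
  by move=> /(_ u)/psi0[b _ /esym/eqP]; apply/negP.
have [N N0 Ngood] : exists2 N, (0 < N)%N & forall g, Bu3 g -> good N (coset g).
  have /finite_seqP[r rE] := HA_index.
  suff [N N0 NC] : exists2 N, (0 < N)%N & forall C, C \in r -> good N C.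
    exists N => // g Bg; apply: NC.
    by have : [set coset g | g in Bu3] (coset g) by [exists g]; rewrite rE.
  elim: r {rE} => [|C r [N N0 IHr]]; first by exists 1%N.
  have [M M0 MC] := good1 C; exists (M * N)%N; first by rewrite muln_gt0 M0.
  move=> D; rewrite in_cons => /predU1P[->|/IHr gD]; first exact: goodM.
  by rewrite mulnC; apply: goodM.
exists (quot_mod (multiples A N)), (psi N); split.
- exact: quot_proj_surj.
- exact: fg_finite_mod N0 z_gen.
- apply/seteqP; split=> g /HAP[Bg fg]; apply/HAP; split=> //.
    by move=> u /=; rewrite [phi _]fg raddf0.
  exact: (Ngood g).
Qed.

End FiniteIndex.

Lemma same_quotient_span (R : nzRingType) (U : lmodType R) (G G' : set U) :
  (forall v, G v -> quot_proj G' v = 0) -> (forall v, G' v -> quot_proj G v = 0) ->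
  same_quotient (quot_proj G) (quot_proj G').
Proof.
move=> GG' G'G; have [f fE] := quot_lift (f := @quot_proj R U G') GG'.
have [g gE] := quot_lift (f := @quot_proj R U G) G'G.
exists f; split; last exact: fE.
by exists g => x; rewrite -[x]quot_proj_repr ?fE ?gE ?fE.
Qed.

Lemma V_gens_proj0 (H : set 'M[Λ]_2) h u : H h -> projAH H ((h - 1%:M) *m u) = 0.
Proof.
move=> Hh; apply/quot_proj_eq0; apply: sub_gen_smallest.
by exists h => //; exists u.
Qed.

Lemma sub_HA_AH (H : set 'M[Λ]_2) : H `<=` Bu3 -> H `<=` HA (projAH H).
Proof. by move=> HB h Hh; apply/HAP; split=> [|u]; [exact: HB|exact: V_gens_proj0]. Qed.

Theorem theorem1p2 (H : set 'M[Λ]_2) (A : lmodType Λ)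
    (phi : {linear 'cV[Λ]_2 -> A})
    (H_subgroup : is_subgroup H) (H_Bu3 : H `<=` Bu3)
    (phi_epi : range phi = [set: A]) :
  [/\ [/\ H `<=` HA (projAH H),
          same_quotient (projAH H) (projAH (HA (projAH H))) &
          HA phi = HA (projAH (HA phi))],
      finite_index (HA phi) Bu3 ->
        exists (A' : lmodType Λ) (psi : {linear A -> A'}),
          [/\ range psi = [set: A'],
              finite_set [set: A'] &
              HA phi = HA (psi \o phi)],
      finite_set [set: A] ->
        exists (n : nat) (m : 'I_n -> set Λ) (A_ : 'I_n -> lmodType Λ)
               (iota : forall i, {linear A_ i -> A})
               (pi : forall i, {linear A -> A_ i}),
          [/\ injective m,
              forall i, maximal_ideal (m i),
              forall i, local_at (m i) (A_ i) &
              is_direct_sum iota pi] &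
      forall (I : choiceType) (A_ : I -> lmodType Λ)
             (iota : forall i, {linear A_ i -> A})
             (pi : forall i, {linear A -> A_ i}),
        is_direct_sum iota pi ->
        HA phi = Bu3 `&` \bigcap_(i in [set: I]) HA (pi i \o phi)].
Proof.
split.
- split; first exact: sub_HA_AH.
  + apply: same_quotient_span => _ [h Hh [u _ <-]].
      exact: (V_gens_proj0 u (sub_HA_AH H_Bu3 Hh)).
    by have /HAP[_ fh] := Hh; apply: fh.
  + apply/seteqP; split; first by apply: sub_HA_AH => h [].
    move=> h /HAP[Bh fh]; apply/HAP; split=> // u.
    have /quot_proj_eq0/(_ [set v | phi v = 0]) := fh u.
    apply; split; first exact: (linear_ker_submodule phi).
    by move=> _ [g /HAP[_ fg] [v _ <-]]; apply: fg.
- exact: finite_quotient_same_HA.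
- exact: finite_module_local_decomposition.
- move=> I A_ iota pi dsum; apply/seteqP; split=> h.
    move=> /HAP[Bh fh]; split=> // i _; apply/HAP; split=> // u /=.
    by rewrite [phi _]fh raddf0.
  move=> [Bh fh]; apply/HAP; split=> // u.
  rewrite (dsum_sum dsum (phi _)) fsbig1// => i _.
  have /HAP[_ /(_ u) /= ->] : HA (pi i \o phi) h by exact: fh.
  exact: raddf0.
Qed.
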